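(* Let $n\ge4$ be an integer, let $0<\epsilon<\left(18^{n-3}(n-2)!\right)^{-1}$, and let $X_1,\dots,X_n$ be jointly distributed discrete random variables taking non-negative real values such that always $X_{i+1}\ge X_i+1$ for every $i\in\{1,\dots,n-1\}$. If $(X_1,\dots,X_n)$ has $\epsilon$-indistinguishable $(n-1)$-subsets, then $X_n$ must take values of at least $\exp_2^{n-2}\left(\left(18^{n-3}(n-2)!\,\epsilon\right)^{-1}\right)$ with positive probability, i.e. $$\Pr\left(X_n\ge \exp_2^{n-2}\left(\left(18^{n-3}(n-2)!\,\epsilon\right)^{-1}\right)\right)>0.$$
   Context: $\exp_2(x)=2^x$, and $\exp_2^{k}$ denotes its $k$-fold iterate. The total variation distance between discrete random variables $A,B$ is $\delta(A,B)=\sum_x\max(\Pr(A=x)-\Pr(B=x),0)$. For $X=(X_1,\dots,X_n)$ write $X_{-i}=(X_1,\dots,X_{i-1},X_{i+1},\dots,X_n)$. For always strictly increasing $X_1<\dots<X_n$, $X$ has $\epsilon$-indistinguishable $(n-1)$-subsets if $\delta(X_{-i},X_{-j})\le\epsilon$ for all $i,j\in\{1,\dots,n\}$. *)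

(* Defs.v *)
From HB Require Import structures.
From mathcomp Require Import all_boot all_order all_algebra.
From mathcomp Require Import all_classical all_reals all_analysis.

Set Implicit Arguments.
Unset Strict Implicit.
Unset Printing Implicit Defensive.
Import Order.TTheory GRing.Theory Num.Theory.
Import numFieldNormedType.Exports.

Local Open Scope classical_set_scope.
Local Open Scope ring_scope.

Definition exp2 (R : realType) (x : R) : R := 2 `^ x.

(* A and B stand for random variables with countable range, so that their
   fibres are measurable; the sum over all of S is then the sum over their
   (countably many) values, every other summand being 0. *)
Definition tv_dist (d : measure_display) (T : measurableType d) (R : realType)
    (P : probability T R) (S : choiceType) (A B : T -> S) : \bar R :=
  (\esum_(x in [set: S])
     maxe (P (A @^-1` [set x]) - P (B @^-1` [set x])) 0)%E.

(* lift i enumerates the indices other than i in increasing order. *)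
Definition omit (T E : Type) (n : nat) (X : 'I_n -> T -> E) (i : 'I_n) :
    T -> n.-1.-tuple E :=
  fun t => [tuple X (lift i j) t | j < n.-1].

(* The notion is meant for X with X_1 < ... < X_n everywhere. *)
Definition indistinguishable_subsets (d : measure_display)
    (T : measurableType d) (R : realType) (P : probability T R) (n : nat)
    (X : 'I_n -> {dRV P >-> R}) (eps : R) : Prop :=
  forall i j : 'I_n, (tv_dist P (omit X i) (omit X j) <= eps%:E)%E.

(* Main.v *)
(* Rounding down makes the variables natural numbers x_0 < ... < x_N, and all
   that matters is the resulting finitely additive mass m. For a < b < c, the
   position D of the highest differing binary digit satisfies
   D a c = max (D a b) (D b c) and D a b <> D b c. Comparing the triples inside
   four consecutive variables, indistinguishability forces the steps
   d_a = D x_a x_(a+1) to be monotone up to mass O(eps), so they are increasing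
   (after reversing the order of the x's, if need be) on an event U carrying at
   least a third of the mass. On U, omitting x_(i+1) amounts to omitting d_i, and
   each of the omitted tuples detects U up to mass 2 eps; hence (d_a) under the
   mass restricted to U has 3 eps-indistinguishable subsets. As 2 ^ d_a <= x_N,
   induction gains one exponential per variable while m / eps drops by a factor
   of at most 9. For three variables the values of d_0, d_1 < max(d_0, d_1) are
   compared level by level. The constant so obtained, 4 * 9 ^ (n - 3), is at most
   18 ^ (n - 3) * (n - 2)! for n >= 4. *)
Require Import Defs.
From HB Require Import structures.
From mathcomp Require Import all_boot all_order all_algebra.
From mathcomp Require Import all_classical all_reals all_analysis.
From mathcomp Require Import zify ring lra.

Set Implicit Arguments.
Unset Strict Implicit.
Unset Printing Implicit Defensive.
Import Order.TTheory GRing.Theory Num.Theory.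
Import numFieldNormedType.Exports.

Local Open Scope classical_set_scope.
Local Open Scope ring_scope.


(** * Finitely additive masses *)

(** Quantifying over every [C] pointwise equal to the union makes [m] respect pointwise equality of
    events without an extensionality principle. *)
Definition is_mass (R : realFieldType) (T : Type) (m : pred T -> R) : Prop :=
  (forall A, 0 <= m A) /\
  (forall A B C : pred T, C =1 predU A B -> (forall t, ~~ (A t && B t)) ->
     m C = m A + m B).

(** No renormalisation: the tower bound only involves the ratio of total mass to error. *)
Definition mass_on (R : realFieldType) (T : Type) (m : pred T -> R)
    (U : pred T) : pred T -> R :=
  fun A => m (predI U A).

Section Mass.
Variables (R : realFieldType) (T : Type) (m : pred T -> R).
Hypothesis m_mass : is_mass m.

Lemma is_mass_on (U : pred T) : is_mass (mass_on m U).
Proof.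
have [m0 mU] := m_mass; split=> [A|A B C eqC disj]; first exact: m0.
apply: mU => t; rewrite /= ?eqC /=; first by case: (U t).
by have := disj t; case: (U t) => //; case: (A t).
Qed.

Lemma eq_mass (A B : pred T) : A =1 B -> m A = m B.
Proof.
have [_ mU] := m_mass => eqAB.
have m0 : m pred0 = 0.
  have : m pred0 = m pred0 + m pred0 by apply: mU.
  by lra.
by rewrite (mU B pred0 A) ?m0 ?addr0 // => t /=; rewrite ?eqAB ?orbF ?andbF.
Qed.

Lemma le_mass (A B : pred T) : (forall t, A t -> B t) -> m A <= m B.
Proof.
have [m0 mU] := m_mass => sAB.
rewrite (mU A (predD B A) B) ?lerDl // => t /=.
- by have := sAB t; case: (A t) => //= ->.
- by case: (A t).
Qed.

Lemma mass_predID (A B : pred T) : m A = m (predI B A) + m (predD A B).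
Proof.
have [_ mU] := m_mass.
by apply: mU => t /=; case: (A t); case: (B t).
Qed.

Lemma mass_subadd (A B C : pred T) :
  (forall t, A t -> B t || C t) -> m A <= m B + m C.
Proof.
move=> sA; rewrite (mass_predID A B); apply: lerD; apply: le_mass => t /=.
- by case/andP.
- by case/andP=> /negbTE nB /sA; rewrite nB.
Qed.

Lemma mass_superadd (A B C : pred T) : (forall t, B t || C t -> A t) ->
  (forall t, B t -> ~~ C t) -> m B + m C <= m A.
Proof.
have [_ mU] := m_mass => sA disj.
rewrite -(mU B C (predU B C)) //; first exact: le_mass.
by move=> t; have := disj t; case: (B t) => //= ->.
Qed.

(** In the uses below, [A] and [B] come from one test applied to two different omissions, and [C] is
    an event on which only [A] holds. *)
Lemma mass_gap (A B C : pred T) (e : R) : m A <= m B + e ->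
  (forall t, B t || C t -> A t) -> (forall t, B t -> ~~ C t) -> m C <= e.
Proof. by move=> leAB sA disj; have := mass_superadd sA disj; lra. Qed.

End Mass.

(* x_0, ..., x_N are N.+1 variables; [bump i] skips the index i. *)
Definition indist (R : realFieldType) (T : Type) (m : pred T -> R) (N : nat)
    (x : nat -> T -> nat) (eps : R) : Prop :=
  forall i j, (i <= N)%N -> (j <= N)%N -> forall A : pred (seq nat),
    m (fun t => A (mkseq (fun k => x (bump i k) t) N)) <=
    m (fun t => A (mkseq (fun k => x (bump j k) t) N)) + eps.

(** A test that reads only the first [N] values can be evaluated on the tuple itself, padded with
    the default [0]. *)
Lemma indist_local (R : realFieldType) (T : Type) (m : pred T -> R) (N : nat)
    (x : nat -> T -> nat) (eps : R) (i j : nat) (F : (nat -> nat) -> bool) :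
  is_mass m -> indist m N x eps -> (i <= N)%N -> (j <= N)%N ->
  (forall f g, (forall k, (k < N)%N -> f k = g k) -> F f = F g) ->
  m (fun t => F (fun k => x (bump i k) t)) <=
  m (fun t => F (fun k => x (bump j k) t)) + eps.
Proof.
move=> mc ind iN jN Floc.
have FE l : m (fun t => F (fun k => x (bump l k) t)) =
    m (fun t => F (nth 0%N (mkseq (fun k => x (bump l k) t) N))).
  by apply: eq_mass => // t; apply: Floc => k kN; rewrite nth_mkseq.
by rewrite !FE; apply: (ind i j iN jN (fun s => F (nth 0%N s))).
Qed.

(** * Monotone step sequences *)

Section UpDown.
Variable d : nat -> nat -> nat.
Hypothesis d_sym : forall a b, d a b = d b a.

(* The two properties of the position of the leading differing bit of
   increasing sequences that are also inherited by the reversed sequence. *)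
Definition ultra (N : nat) (f : nat -> nat) : Prop :=
  forall i j k, (i < j)%N -> (j < k)%N -> (k <= N)%N ->
    d (f i) (f k) = maxn (d (f i) (f j)) (d (f j) (f k)) /\
    d (f i) (f j) <> d (f j) (f k).

Definition step (f : nat -> nat) (a : nat) : nat := d (f a) (f a.+1).

Definition rise (f : nat -> nat) (a : nat) : bool := (step f a < step f a.+1)%N.

Definition up (f : nat -> nat) (K : nat) : bool := all (rise f) (iota 0 K).

Lemma upP f K : reflect (forall a, (a < K)%N -> rise f a) (up f K).
Proof.
apply: (iffP allP) => h a; first by move=> aK; apply: h; rewrite mem_iota.
by rewrite mem_iota /= => aK; apply: h.
Qed.

Lemma step_neq N f a : ultra N f -> (a.+2 <= N)%N -> step f a <> step f a.+1.
Proof. by move=> uf aN; have [] := uf a a.+1 a.+2 (ltnSn _) (ltnSn _) aN. Qed.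

Lemma up_step N f K j a : ultra N f -> up f K -> (K.+1 <= N)%N ->
  (j <= K)%N -> (a <= j)%N -> (step f a <= step f j)%N.
Proof.
move=> uf /upP fup KN; elim: j a => [|j IH] a jK aj.
  by move: aj; rewrite leqn0 => /eqP ->.
move: aj; rewrite leq_eqVlt => /orP[/eqP -> //|aj].
by apply: leq_trans (IH a (ltnW jK) _) (ltnW (fup j jK)).
Qed.

(** The distance is the largest of the steps in between, which for rising steps is the last one. *)
Lemma up_dE N f K i j : ultra N f -> up f K -> (K.+1 <= N)%N ->
  (j <= K)%N -> (i <= j)%N -> d (f i) (f j.+1) = step f j.
Proof.
move=> uf fup KN; elim: j => [|j IH] jK ij.
  by move: ij; rewrite leqn0 => /eqP ->.
move: ij; rewrite leq_eqVlt => /orP[/eqP -> //|ij].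
have [|-> _] := uf i j.+1 j.+2 ij (ltnSn _); first by lia.
rewrite IH //; last by lia.
by apply/maxn_idPr/ltnW; move/upP: fup; apply.
Qed.

(** Omitting an inner [x_(i+1)] merges steps [i] and [i+1] into the larger one, step [i+1]; so
    exactly step [i] is lost. *)
Lemma up_step_bump N f K i a : ultra N f -> up f K -> (K.+1 <= N)%N ->
  (a < K)%N -> step (f \o bump i.+1) a = step f (bump i a).
Proof.
move=> uf fup KN aK; rewrite /step /=.
have -> : bump i.+1 a.+1 = (bump i a).+1 by rewrite /bump; lia.
by apply: (up_dE uf fup KN); rewrite /bump; lia.
Qed.

Lemma up_bump N f K i : ultra N f -> up f K.+1 -> (K.+2 <= N)%N ->
  up (f \o bump i) K.
Proof.
move=> uf fup KN; apply/upP => a aK.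
(* Steps [a] and [a.+1] of the thinned sequence equal the original steps [b < c], the last ones that
   they span. *)
have [b [bE b1]] : exists b, bump i a.+1 = b.+1 /\ (bump i a <= b)%N.
  by exists (bump i a.+1).-1; rewrite /bump; lia.
have [c [cE c1]] : exists c, bump i a.+2 = c.+1 /\ (b < c)%N.
  by exists (bump i a.+2).-1; move: bE; rewrite /bump; lia.
have cK : (c <= K.+1)%N by move: cE; rewrite /bump; lia.
rewrite /rise /step /= bE cE.
rewrite (up_dE uf fup KN _ b1) ?(up_dE uf fup KN _ c1) //; last by lia.
have /upP /(_ b) fb := fup.
apply: leq_trans (fb _) (up_step uf fup KN _ _); lia.
Qed.


(** * Neighbouring steps rise or fall together up to mass O(eps) *)

Section Process.
Variables (R : realFieldType) (T : Type) (m : pred T -> R) (N : nat).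
Variables (x : nat -> T -> nat) (eps : R).
Hypothesis m_mass : is_mass m.
Hypothesis x_ultra : forall t, ultra N (x^~ t).
Hypothesis x_indist : indist m N x eps.

(** With [s] for the steps, the test [F] reads [s_a < s_(a+1)] when [x_(a+3)] is omitted, and
    [s_a < max(s_(a+1), s_(a+2))] when [x_(a+2)] is. The event is where only the second holds. *)
Lemma valley_lt a : (a.+3 <= N)%N ->
  m (fun t => (step (x^~ t) a.+1 <= step (x^~ t) a)%N &&
              (step (x^~ t) a < step (x^~ t) a.+2)%N) <= eps.
Proof.
move=> aN; pose F (f : nat -> nat) := (step f a < step f a.+1)%N.
have Floc f g : (forall k, (k < N)%N -> f k = g k) -> F f = F g.
  by move=> fg; rewrite /F /step !fg //; lia.
have i2N : (a.+2 <= N)%N by lia.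
have := indist_local m_mass x_indist i2N aN Floc.
have bE : (bump a.+2 a = a) * (bump a.+2 a.+1 = a.+1) * (bump a.+2 a.+2 = a.+3)
    * (bump a.+3 a = a) * (bump a.+3 a.+1 = a.+1) * (bump a.+3 a.+2 = a.+2).
  by rewrite /bump; repeat split; lia.
move=> /mass_gap -> // t; rewrite /F /step /= !bE;
  have [E _] := x_ultra t (ltnSn a.+1) (ltnSn a.+2) aN; rewrite ?E; lia.
Qed.

(** Here omitting [x_a] gives [s_(a+1) < s_(a+2)] and omitting [x_(a+1)] gives
    [max(s_a, s_(a+1)) < s_(a+2)]; the event is where only the first holds. *)
Lemma valley_ge a : (a.+3 <= N)%N ->
  m (fun t => (step (x^~ t) a.+1 < step (x^~ t) a.+2)%N &&
              (step (x^~ t) a.+2 <= step (x^~ t) a)%N) <= eps.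
Proof.
move=> aN; pose F (f : nat -> nat) := (step f a < step f a.+1)%N.
have Floc f g : (forall k, (k < N)%N -> f k = g k) -> F f = F g.
  by move=> fg; rewrite /F /step !fg //; lia.
have i0N : (a <= N)%N by lia.
have i1N : (a.+1 <= N)%N by lia.
have i2N : (a.+2 <= N)%N by lia.
have := indist_local m_mass x_indist i0N i1N Floc.
have bE : (bump a a = a.+1) * (bump a a.+1 = a.+2) * (bump a a.+2 = a.+3)
    * (bump a.+1 a = a) * (bump a.+1 a.+1 = a.+2) * (bump a.+1 a.+2 = a.+3).
  by rewrite /bump; repeat split; lia.
move=> /mass_gap -> // t; rewrite /F /step /= !bE;
  have [E _] := x_ultra t (ltnSn a) (ltnSn a.+1) i2N; rewrite ?E; lia.
Qed.

(** The two preceding lemmas bound valleys by 2 eps. Omitting [x_(a+3)] or [x_a] shows that a rise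
    at [a] has at most eps more mass than one at [a.+1]; hence peaks outweigh valleys by at most
    eps, and 2 + 3 = 5. *)
Lemma rise_change a : (a.+3 <= N)%N ->
  m (fun t => rise (x^~ t) a != rise (x^~ t) a.+1) <= 5 * eps.
Proof.
move=> aN.
have valley : m (fun t => ~~ rise (x^~ t) a && rise (x^~ t) a.+1) <= 2 * eps.
  have := valley_lt aN; have := valley_ge aN.
  set A := (fun _ => _); set B := (fun _ => _) => hA hB.
  suff /(mass_subadd m_mass) : forall t,
      ~~ rise (x^~ t) a && rise (x^~ t) a.+1 -> A t || B t by lra.
  by move=> t; rewrite /A /B /rise; lia.
have peak : m (fun t => rise (x^~ t) a && ~~ rise (x^~ t) a.+1) <= 3 * eps.
  pose F (f : nat -> nat) := rise f a.
  have Floc f g : (forall k, (k < N)%N -> f k = g k) -> F f = F g.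
    by move=> fg; rewrite /F /rise /step !fg //; lia.
  have i0N : (a <= N)%N by lia.
  have := indist_local m_mass x_indist aN i0N Floc.
  pose A t := rise (x^~ t) a; pose B t := rise (x^~ t) a.+1.
  have -> : m (fun t => F (fun k => x (bump a.+3 k) t)) = m A.
    apply: eq_mass => // t; rewrite /F /A /rise /step /=.
    by congr (d (x _ t) (x _ t) < d (x _ t) (x _ t))%N; rewrite /bump; lia.
  have -> : m (fun t => F (fun k => x (bump a k) t)) = m B.
    apply: eq_mass => // t; rewrite /F /B /rise /step /=.
    by congr (d (x _ t) (x _ t) < d (x _ t) (x _ t))%N; rewrite /bump; lia.
  rewrite (mass_predID m_mass A B) (mass_predID m_mass B A).
  have -> : m (predI B A) = m (predI A B).
    by apply: eq_mass => // t /=; rewrite andbC.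
  have -> : m (fun t => A t && ~~ B t) = m (predD A B).
    by apply: eq_mass => // t /=; rewrite andbC.
  by move: valley; rewrite -/(predD B A); lra.
apply: le_trans (_ : 2 * eps + 3 * eps <= _); last by lra.
apply: le_trans (lerD valley peak).
apply: mass_subadd => // t.
by case: (rise _ a); case: (rise _ a.+1).
Qed.

Lemma rise_const K : (K.+2 <= N)%N ->
  m (fun t => ~~ all (fun a => rise (x^~ t) a == rise (x^~ t) 0%N) (iota 0 K.+1))
    <= (5 * K)%:R * eps.
Proof.
elim: K => [|K IH] KN.
  rewrite muln0 mul0r.
  have [_ mU] := m_mass.
  have := mU pred0 pred0 pred0 (fun=> erefl) (fun=> isT).
  rewrite (@eq_mass _ _ _ m_mass _ pred0) => [|t /=]; first by lra.
  by rewrite eqxx.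
have := rise_change KN; have := IH (ltnW KN).
set A := (fun _ => _); set B := (fun _ => _) => hA hB.
have -> : (5 * K.+1)%:R * eps = (5 * K)%:R * eps + 5 * eps.
  by rewrite mulnS natrD; ring.
apply: le_trans (lerD hA hB); apply: mass_subadd => // t.
rewrite /A /B; have [/allP h|//] := boolP (all _ (iota 0 K.+1)).
rewrite -[K.+2]addn1 iotaD all_cat negb_and => /orP[/negP[]|]; first exact/allP.
have := h K; rewrite mem_iota => /(_ (ltnSn _)) /eqP ->.
by rewrite [iota _ 1]/= all_seq1 add0n eq_sym.
Qed.

Lemma up_or_down K : (K.+2 <= N)%N ->
  m predT <= m (fun t => up (x^~ t) K.+1) +
             m (fun t => all (fun a => ~~ rise (x^~ t) a) (iota 0 K.+1)) +
             (5 * K)%:R * eps.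
Proof.
move=> KN; have := rise_const KN; set C := (fun _ => _).
set A := (fun _ => up _ _); set B := (fun _ => _).
have h1 : m predT <= m (predU A B) + m C.
  apply: mass_subadd => // t _; rewrite /C.
  have [/allP h|_] := boolP (all _ _); last by rewrite orbT.
  rewrite orbF; change (A t || B t); apply/orP.
  case r0 : (rise (x^~ t) 0%N); [left|right].
    by apply/upP => a aK; have := h a; rewrite mem_iota r0 => /(_ aK) /eqP.
  apply/allP => a aK.
  by have := h a aK; rewrite r0 => /eqP ->.
have h2 : m (predU A B) <= m A + m B by apply: mass_subadd.
by lra.
Qed.

End Process.

(** * From a rising sequence to the sequence of its steps *)

Section UpProcess.
Variables (R : realFieldType) (T : Type) (m : pred T -> R) (n : nat).
Variables (x : nat -> T -> nat) (eps : R).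
Hypothesis m_mass : is_mass m.
Hypothesis x_ultra : forall t, ultra n.+3 (x^~ t).
Hypothesis x_indist : indist m n.+3 x eps.

Let U t := up (x^~ t) n.+2.
Let V i t := up (fun k => x (bump i k) t) n.+1.

Lemma up_sub_bump i t : U t -> V i t.
Proof. by rewrite /U => Ut; apply: (up_bump i (x_ultra t) Ut). Qed.

(** For [i = 1], the thinned tuple rises but the full one does not only if [s_1 <= s_0 < s_2], an
    event of mass at most eps by [valley_lt]. Since every [V i] contains [U], comparing [V i] with
    [V 1] costs one more eps. *)
Lemma up_bump_diff i : (i <= n.+3)%N -> m (predD (V i) U) <= 2 * eps.
Proof.
move=> iN.
have Floc f g : (forall k, (k < n.+3)%N -> f k = g k) -> up f n.+1 = up g n.+1.
  move=> fg; apply: eq_in_all => a; rewrite mem_iota => /andP[_ an].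
  by rewrite /rise /step !fg //; lia.
have := indist_local m_mass x_indist iN (isT : (1 <= n.+3)%N) Floc.
rewrite -/(V i) -/(V 1%N) => h1.
have E j : m (V j) = m U + m (predD (V j) U).
  rewrite (mass_predID m_mass (V j) U); congr (_ + _).
  by apply: eq_mass => // t /=; case Ut : (U t) => //=; rewrite up_sub_bump.
have h2 : m (predD (V 1%N) U) <= eps.
  have := valley_lt m_mass x_ultra x_indist (isT : (3 <= n.+3)%N).
  apply: le_trans; apply: le_mass => // t /= /andP[nU /upP Vt].
  have := Vt 0%N isT; rewrite /rise /step /=.
  rewrite (_ : bump 1 0 = 0)%N // (_ : bump 1 1 = 2)%N // (_ : bump 1 2 = 3)%N //.
  have [-> _] := x_ultra t (isT : (0 < 1)%N) (isT : (1 < 2)%N) isT.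
  move=> h; suff : ~~ rise (x^~ t) 0%N by rewrite /rise /step; lia.
  apply: contra nU => r0; apply/upP => -[//|[|a] an].
    by rewrite /rise /step; lia.
  exact: (Vt a.+1).
by move: h1; rewrite !E; lra.
Qed.

(** The test [F] checks that the thinned tuple rises and that [A] accepts its steps. Exchanging the
    omitted index costs eps, and returning from [V j.+1] to [U] costs 2 eps. Off [U] the junk value
    [a] keeps the new variables strictly increasing. *)
Lemma up_indist :
  indist (mass_on m U) n.+2 (fun a t => if U t then step (x^~ t) a else a)
    (3 * eps).
Proof.
move=> i j iN jN A.
pose F f := up f n.+1 && A (mkseq (step f) n.+2).
have Floc f g : (forall k, (k < n.+3)%N -> f k = g k) -> F f = F g.
  move=> fg; congr (_ && A _).
    apply: eq_in_all => a; rewrite mem_iota => /andP[_ an].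
    by rewrite /rise /step !fg //; lia.
  apply/eq_in_map => a; rewrite mem_iota => /andP[_ an].
  by rewrite /step !fg //; lia.
pose y a t := if U t then step (x^~ t) a else a.
have yE l t : U t -> mkseq (fun k => y (bump l k) t) n.+2
    = mkseq (step (fun k => x (bump l.+1 k) t)) n.+2.
  rewrite /y => Ut; rewrite Ut.
  apply/eq_in_map => a; rewrite mem_iota => /andP[_ an].
  by rewrite /U in Ut; rewrite -(up_step_bump l (x_ultra t) Ut).
apply: le_trans (_ : m (fun t => F (fun k => x (bump i.+1 k) t)) <= _).
  rewrite {1}/mass_on; apply: le_mass => // t /= /andP[Ut]; rewrite yE // => At.
  by rewrite /F At andbT; exact: (up_sub_bump _ Ut).
apply: le_trans (indist_local m_mass x_indist (iN : (i.+1 <= n.+3)%N)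
  (jN : (j.+1 <= n.+3)%N) Floc) _.
have := up_bump_diff (jN : (j.+1 <= n.+3)%N).
set C := predD _ _ => hC; pose B t := F (fun k => x (bump j.+1 k) t).
rewrite -/B.
suff : m B <= mass_on m U (fun t => A (mkseq (fun k => y (bump j k) t) n.+2)) +
    m C by rewrite /y; lra.
apply: mass_subadd => // t; rewrite /B /C /F /V /= => /andP[-> At].
by case: (orP (orbN (U t))) => Ut; [rewrite yE // Ut At | rewrite Ut orbT].
Qed.

End UpProcess.

(** * Reversing the order of the variables *)

Lemma ultra_rev N f : ultra N f -> ultra N (fun k => f (N - k)%N).
Proof.
move=> uf i j k ij jk kN.
have [|||E1 E2] := uf (N - k)%N (N - j)%N (N - i)%N; try lia.
rewrite (d_sym (f (N - i)%N) (f (N - k)%N)) (d_sym (f (N - i)%N)).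
rewrite (d_sym (f (N - j)%N) (f (N - k)%N)) maxnC.
by split=> // /esym.
Qed.

Lemma indist_rev (R : realFieldType) (T : Type) (m : pred T -> R) (N : nat)
    (x : nat -> T -> nat) (eps : R) :
  is_mass m -> indist m N x eps -> indist m N (fun k => x (N - k)%N) eps.
Proof.
move=> mc ind i j iN jN A.
have E l : (l <= N)%N -> m (fun t => A (mkseq (fun k => x (N - bump l k)%N t) N))
    = m (fun t => A (rev (mkseq (fun k => x (bump (N - l) k) t) N))).
  move=> lN; apply: eq_mass => // t; congr (A _).
  apply: (@eq_from_nth _ 0%N); rewrite ?size_rev ?size_mkseq // => a aN.
  rewrite nth_rev ?size_mkseq // !nth_mkseq //; last by lia.
  by congr (x _ t); rewrite /bump; lia.
by rewrite !E //; apply: (ind _ _ _ _ (fun s => A (rev s))); lia.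
Qed.

(** Consecutive steps are distinct, so steps that never rise strictly decrease, and they increase
    when read backwards. *)
Lemma down_up_rev n f : ultra n.+3 f ->
  all (fun a => ~~ rise f a) (iota 0 n.+2) -> up (fun k => f (n.+3 - k)%N) n.+2.
Proof.
move=> uf /allP fd; apply/upP => a an.
have /fd : (n.+1 - a)%N \in iota 0 n.+2 by rewrite mem_iota; lia.
have := step_neq uf (_ : ((n.+1 - a).+2 <= n.+3)%N).
rewrite /rise /step /=.
have -> : (n.+3 - a.+1 = (n.+1 - a).+1)%N by lia.
have -> : (n.+3 - a = (n.+1 - a).+2)%N by lia.
have -> : (n.+3 - a.+2 = (n.+1 - a))%N by lia.
rewrite (d_sym (f _.+2)) (d_sym (f _.+1) (f (n.+1 - a)%N)).
by move=> /(_ _); lia.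
Qed.

End UpDown.

(** * The highest differing binary digit *)

Lemma split_height_ex (a b : nat) : exists e, (a %/ 2 ^ e == b %/ 2 ^ e)%N.
Proof.
exists (maxn a b); rewrite !divn_small //.
- by apply: leq_ltn_trans (leq_maxr a b) (ltn_expl _ _).
- by apply: leq_ltn_trans (leq_maxl a b) (ltn_expl _ _).
Qed.

(** This is the bit length of the bitwise exclusive or of [a] and [b]. *)
Definition split_height (a b : nat) : nat := ex_minn (split_height_ex a b).

(* For a <> b, the position of the highest binary digit in which a and b
   differ; the junk value at a = b is 0. *)
Definition split_bit (a b : nat) : nat := (split_height a b).-1.

Lemma split_height_le (a b e : nat) :
  (split_height a b <= e)%N = (a %/ 2 ^ e == b %/ 2 ^ e)%N.
Proof.
rewrite /split_height; case: ex_minnP => h /eqP hE hmin.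
apply/idP/idP => [he|]; last exact: hmin.
by rewrite -(subnKC he) expnD !divnMA hE.
Qed.

Lemma split_height_gt0 (a b : nat) : (a < b)%N -> (0 < split_height a b)%N.
Proof. by rewrite lt0n -leqn0 split_height_le !divn1; lia. Qed.

Lemma split_bit_sym (a b : nat) : split_bit a b = split_bit b a.
Proof.
congr _.-1; apply/eqP; rewrite eqn_leq !split_height_le.
by rewrite eq_sym -split_height_le leqnn /= eq_sym -split_height_le.
Qed.

(** Dividing by [2 ^ e] preserves [a <= b <= c], and the outer two quotients agree exactly when all
    three do. *)
Lemma split_height_max (a b c : nat) : (a <= b)%N -> (b <= c)%N ->
  split_height a c = maxn (split_height a b) (split_height b c).
Proof.
move=> ab bc; have le3 e : (split_height a c <= e)%N =
    (maxn (split_height a b) (split_height b c) <= e)%N.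
  rewrite geq_max !split_height_le.
  have := leq_div2r (2 ^ e) ab; have := leq_div2r (2 ^ e) bc.
  by move: (a %/ _)%N (b %/ _)%N (c %/ _)%N => u v w; lia.
by apply/eqP; rewrite eqn_leq le3 leqnn -le3 leqnn.
Qed.

(** If both heights were [h.+1], the quotients by [2 ^ h] would be three distinct numbers with the
    same half. *)
Lemma split_height_neq (a b c : nat) : (a < b)%N -> (b < c)%N ->
  split_height a b <> split_height b c.
Proof.
move=> ab bc; have := split_height_gt0 ab.
case hE: (split_height a b) => [//|h] _ /esym hE'.
have := split_height_le a b h.+1; have := split_height_le b c h.+1.
have := split_height_le a b h; have := split_height_le b c h.
rewrite hE hE' ltnn leqnn !expnSr !divnMA.
have := leq_div2r (2 ^ h) (ltnW ab); have := leq_div2r (2 ^ h) (ltnW bc).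
by move: (a %/ _)%N (b %/ _)%N (c %/ _)%N => u v w; lia.
Qed.

Lemma ltn_chain (N : nat) (f : nat -> nat) (i j : nat) :
  (forall k, (k < N)%N -> (f k < f k.+1)%N) ->
  (i < j)%N -> (j <= N)%N -> (f i < f j)%N.
Proof.
move=> finc; elim: j => // j IH; rewrite ltnS leq_eqVlt => /orP[/eqP ->|ij] jN.
  exact: finc.
by apply: ltn_trans (IH ij (ltnW jN)) (finc _ _).
Qed.

Lemma ultra_split_bit (N : nat) (f : nat -> nat) :
  (forall k, (k < N)%N -> (f k < f k.+1)%N) -> ultra split_bit N f.
Proof.
move=> finc i j k ij jk kN.
have fij := ltn_chain finc ij (ltnW (leq_trans jk kN)).
have fjk := ltn_chain finc jk kN.
have := split_height_max (ltnW fij) (ltnW fjk).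
have := split_height_neq fij fjk.
have := split_height_gt0 fij; have := split_height_gt0 fjk.
by rewrite /split_bit; lia.
Qed.

(** At the highest differing digit the quotient of [b] exceeds that of [a], hence is positive. *)
Lemma expn_split_bit (a b : nat) : (a < b)%N -> (2 ^ split_bit a b <= b)%N.
Proof.
move=> ab; have := split_height_gt0 ab; rewrite /split_bit.
case hE: (split_height a b) => [//|h] _ /=.
have := split_height_le a b h; rewrite hE ltnn.
have := leq_div2r (2 ^ h) (ltnW ab).
have <- : (0 < b %/ 2 ^ h)%N = (2 ^ h <= b)%N by rewrite divn_gt0 ?expn_gt0.
by move: (a %/ _)%N (b %/ _)%N => u v; lia.
Qed.

(** The event is covered by the [M] events [g < v <= f] with [1 <= v <= M], each of mass at most eps
    because [g <= f]. *)
Lemma mass_ltn_levels (R : realFieldType) (T : Type) (m : pred T -> R)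
    (f g : T -> nat) (eps : R) (M : nat) : is_mass m ->
  (forall v, m (fun t => v <= f t)%N <= m (fun t => v <= g t)%N + eps) ->
  (forall t, (g t <= f t)%N) ->
  m (fun t => (g t < f t)%N && (f t <= M)%N) <= M%:R * eps.
Proof.
move=> mc hlev gf; elim: M => [|M IH].
  rewrite mul0r (@eq_mass _ _ _ mc _ pred0) => [|t /=]; last by lia.
  have [_ mU] := mc.
  by have := mU pred0 pred0 pred0 (fun=> erefl) (fun=> isT); lra.
have lev : m (fun t => (g t < M.+1)%N && (M.+1 <= f t)%N) <= eps.
  by have /mass_gap -> // := hlev M.+1; move=> t /=; have := gf t; lia.
rewrite -[M.+1]addn1 natrD mulrDl mul1r addn1.
by apply: le_trans (lerD IH lev); apply: mass_subadd => // t; lia.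
Qed.

(** Omitting [x_1] leaves [D 0 2]; omitting [x_2] or [x_0] leaves [D 0 1] or [D 1 2]. One of these
    is strictly below [D 0 2], so if [D 0 2 <= M], one of two events of mass at most [M * eps]
    occurs. *)
Lemma three_indist (R : realFieldType) (T : Type) (m : pred T -> R)
    (x : nat -> T -> nat) (eps : R) (M : nat) :
  is_mass m -> (forall t k, (k < 2)%N -> (x k t < x k.+1 t)%N) ->
  indist m 2 x eps ->
  m predT <= 2 * (M%:R * eps) + m (fun t => 2 ^ M.+1 <= x 2 t)%N.
Proof.
move=> mc xinc xind.
pose D i j t := split_bit (x i t) (x j t).
have DE t : D 0 2 t = maxn (D 0 1 t) (D 1 2 t) /\ D 0 1 t <> D 1 2 t.
  by apply: (ultra_split_bit (xinc t)).
have lev i v : (i <= 2)%N ->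
    m (fun t => v <= D 0 2 t)%N <= m (fun t => v <= D (bump i 0) (bump i 1) t)%N + eps.
  move=> i2; pose F (f : nat -> nat) := (v <= split_bit (f 0) (f 1))%N.
  apply: (indist_local (F := F) mc xind (isT : (1 <= 2)%N) i2).
  by move=> f g fg; rewrite /F !fg.
have le1 t : (D 0 1 t <= D 0 2 t)%N by have [-> _] := DE t; apply: leq_maxl.
have le2 t : (D 1 2 t <= D 0 2 t)%N by have [-> _] := DE t; apply: leq_maxr.
have L1 := mass_ltn_levels M mc (fun v => lev 2 v isT) le1.
have L2 := mass_ltn_levels M mc (fun v => lev 0 v isT) le2.
have Lbig : m (fun t => M < D 0 2 t)%N <= m (fun t => 2 ^ M.+1 <= x 2 t)%N.
  apply: le_mass => // t MD; apply: leq_trans (expn_split_bit _); last first.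
    exact: (ltn_chain (xinc t) (isT : (0 < 2)%N)).
  by rewrite leq_exp2l.
move: L1 L2; set A1 := (fun _ => _); set A2 := (fun _ => _) => L1 L2.
have : m predT <= m (predU A1 A2) + m (fun t => M < D 0 2 t)%N.
  apply: mass_subadd => // t _; have [] := DE t; rewrite /A1 /A2 /=.
  by move: (D 0 1 t)%N (D 1 2 t)%N (D 0 2 t)%N => u v w; lia.
have : m (predU A1 A2) <= m A1 + m A2 by apply: mass_subadd.
lra.
Qed.

(** * The tower bound for natural-valued variables *)

Section Tower.
Variable R : realType.

Lemma exp2_natr (k : nat) : exp2 (k%:R : R) = (2 ^ k)%:R.
Proof. by rewrite /exp2 powR_mulrn // natrX. Qed.

Lemma le_exp2 (a b : R) : a <= b -> exp2 a <= exp2 b.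
Proof. by move=> ab; apply: ler_powR => //; rewrite ler1n. Qed.

Lemma le_iter_exp2 (k : nat) (a b : R) : a <= b ->
  iter k (@exp2 R) a <= iter k (@exp2 R) b.
Proof. by move=> ab; elim: k => //= k; apply: le_exp2. Qed.

Section Lift.
Variables (T : Type) (m : pred T -> R) (k : nat) (x : nat -> T -> nat).
Variable eps : R.
Hypothesis m_mass : is_mass m.
Hypothesis eps_gt0 : 0 < eps.
Hypothesis mass_gt : 4 * 9 ^+ k.+1 * eps < m predT.

(** The induction step, with [z] either [x] or its reversal. Restricting to [U] keeps a third of the
    mass and triples the error, which is the factor 9; the power of two below [x_(k+3)] supplies the
    extra exponential. *)
Lemma tower_lift (z : nat -> T -> nat) :
  (forall (m' : pred T -> R) (y : nat -> T -> nat) (e : R), is_mass m' ->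
     (forall t i, (i < k.+2)%N -> (y i t < y i.+1 t)%N) ->
     indist m' k.+2 y e -> 0 < e -> 4 * 9 ^+ k * e < m' predT ->
     0 < m' (fun t => iter k.+1 (@exp2 R) (m' predT / (4 * 9 ^+ k * e))
                      <= (y k.+2 t)%:R)) ->
  (forall t, ultra split_bit k.+3 (z^~ t)) -> indist m k.+3 z eps ->
  (forall t, (2 ^ step split_bit (z^~ t) k.+2 <= x k.+3 t)%N) ->
  m predT / 3 <= m (fun t => up split_bit (z^~ t) k.+2) ->
  0 < m (fun t => iter k.+2 (@exp2 R) (m predT / (4 * 9 ^+ k.+1 * eps))
                  <= (x k.+3 t)%:R).
Proof.
move=> IH zu zind zx mU.
pose U t := up split_bit (z^~ t) k.+2.
pose y a t := if U t then step split_bit (z^~ t) a else a.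
have WE : mass_on m U predT = m U.
  by rewrite /mass_on; apply: eq_mass => // t; rewrite /= andbT.
have c0 : 0 < 4 * 9 ^+ k :> R by rewrite mulr_gt0 // exprn_gt0.
have big : 4 * 9 ^+ k * (3 * eps) < mass_on m U predT.
  by rewrite WE; apply: lt_le_trans mU; move: mass_gt; rewrite exprS; lra.
have yinc t i : (i < k.+2)%N -> (y i t < y i.+1 t)%N.
  by rewrite /y; case: ifP => // /upP zr ik; apply: zr.
have := IH _ y _ (is_mass_on m_mass U) yinc
  (up_indist m_mass zu zind) (mulr_gt0 (ltr0n _ 3) eps_gt0) big.
move/lt_le_trans; apply; rewrite {1}/mass_on; apply: le_mass => // t /=.
rewrite /y => /andP[Ut]; rewrite Ut => yt.
apply: (@le_trans _ _ (exp2 (step split_bit (z^~ t) k.+2)%:R)).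
  apply/le_exp2; apply: (le_trans _ yt); apply: (@le_iter_exp2 k.+1).
  have c1 : 0 < 4 * 9 ^+ k * (3 * eps) by rewrite mulr_gt0 // mulr_gt0.
  have c2 : 0 < 4 * 9 ^+ k.+1 * eps by rewrite mulr_gt0 // mulr_gt0 // exprn_gt0.
  rewrite WE (ler_pdivlMr _ _ c1) mulrAC (ler_pdivrMr _ _ c2).
  (* The cross-multiplied comparison is 36 times this inequality. *)
  have : 0 <= (m U - m predT / 3) * (9 ^+ k * eps).
    by rewrite mulr_ge0 ?subr_ge0 // mulr_ge0 // ?exprn_ge0 // ltW.
  by rewrite exprS; lra.
by rewrite exp2_natr ler_nat.
Qed.

End Lift.

Lemma tower (k : nat) : forall (T : Type) (m : pred T -> R)
    (x : nat -> T -> nat) (eps : R),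
  is_mass m -> (forall t i, (i < k.+2)%N -> (x i t < x i.+1 t)%N) ->
  indist m k.+2 x eps -> 0 < eps -> 4 * 9 ^+ k * eps < m predT ->
  0 < m (fun t => iter k.+1 (@exp2 R) (m predT / (4 * 9 ^+ k * eps))
                  <= (x k.+2 t)%:R).
Proof.
elim: k => [|k IH] T m x eps mc xinc xind eps0 big.
  rewrite expr0 mulr1 /= in big *.
  have W0 : 0 < m predT by apply: le_lt_trans big; rewrite mulr_ge0 // ltW.
  have e40 : 0 < 4 * eps by rewrite mulr_gt0.
  set L := m predT / (4 * eps).
  have LE : m predT = L * (4 * eps) by rewrite divfK ?gt_eqF.
  have L0 : 0 <= L by rewrite divr_ge0 // ltW.
  have /andP[M1 M2] := truncn_itv L0.
  (* With the constant 4, the loss [2 * truncn L * eps] is at most half of the total mass. *)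
  have := three_indist (Num.truncn L) mc xinc xind.
  set A := (fun _ => _) => h.
  have : m A <= m (fun t => exp2 L <= (x 2 t)%:R).
    apply: le_mass => // t At; apply: le_trans (le_exp2 (ltW M2)) _.
    by rewrite exp2_natr ler_nat.
  apply: lt_le_trans.
  have : 0 <= (L - (Num.truncn L)%:R) * eps by rewrite mulr_ge0 ?subr_ge0 // ltW.
  by lra.
have xu t : ultra split_bit k.+3 (x^~ t) by exact: (ultra_split_bit (xinc t)).
have := up_or_down mc xu xind (leqnn _).
set A := (fun _ => up _ _ _); set B := (fun _ => all _ _); set e := (5 * _)%:R * eps => h.
have he : e <= m predT / 3.
  (* Here 12 * 9 ^ k is a third of 4 * 9 ^ (k + 1), so neither rising nor falling has at most a
     third of the mass; one of the two therefore has at least a third. *)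
  have : (5 * k.+1 <= 12 * 9 ^ k)%N.
    by have := ltn_expl k (isT : (1 < 9)%N); lia.
  rewrite -(ler_nat R) (natrM _ 12) natrX => h1.
  have : 0 <= ((12 * 9 ^+ k) - (5 * k.+1)%:R) * eps.
    by rewrite mulr_ge0 ?subr_ge0 // ltW.
  by rewrite /e; move: big; rewrite exprS; lra.
have [hA|hA] := lerP (m predT / 3) (m A).
  apply: (tower_lift mc eps0 big (z := x)) => // [m' y e' |t].
    exact: IH.
  by apply: expn_split_bit; apply: xinc.
have hB : m predT / 3 <= m B by lra.
apply: (tower_lift mc eps0 big (z := fun i => x (k.+3 - i)%N)) => // [m' y e' |t||t|].
- exact: IH.
- exact: (ultra_rev split_bit_sym (xu t)).
- exact: indist_rev.
(* The last step of the reversal is the first of [x], and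
   [2 ^ split_bit x_0 x_1 <= x_1 < x_(k+3)]. *)
- rewrite /step subnn subSnn split_bit_sym.
  apply: leq_trans (expn_split_bit (xinc t 0%N isT)) _.
  by case: (k) (xinc t) => [|k'] xi; apply/ltnW/(ltn_chain xi).
apply: (le_trans hB); apply: le_mass => // t.
exact: (down_up_rev split_bit_sym (xu t)).
Qed.

End Tower.

(** * From random variables to natural-valued ones *)

Section CountableFibres.
Variables (d : measure_display) (T : measurableType d) (R : realType).
Variables (P : probability T R) (S : choiceType).

Lemma measurable_countable_preimage (Z : T -> S) (A : set S) : countable A ->
  (forall s, measurable (Z @^-1` [set s])) -> measurable (Z @^-1` A).
Proof.
move=> /countable_injP[f finj] mZ.
have -> : Z @^-1` A = \bigcup_k Z @^-1` (A `&` f @^-1` [set k]).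
  by apply/seteqP; split=> [t At|t [k _ []]] //; exists (f (Z t)).
apply: bigcup_measurable => k _.
have [[s [As fs]]|no] := pselect (exists s, A s /\ f s = k).
  suff -> : A `&` f @^-1` [set k] = [set s] by exact: mZ.
  apply/seteqP; split=> [u [Au fu]|u ->] //.
  by apply: finj; rewrite ?inE // fs.
suff -> : A `&` f @^-1` [set k] = set0 by rewrite preimage_set0.
by apply/seteqP; split=> // u [Au fu]; apply: no; exists u.
Qed.

Lemma measurable_countable_range (Z : T -> S) (A : set S) :
  countable (range Z) -> (forall s, measurable (Z @^-1` [set s])) ->
  measurable (Z @^-1` A).
Proof.
move=> cZ mZ.
have -> : Z @^-1` A = Z @^-1` (A `&` range Z).
  by apply/seteqP; split=> [t At|t []] //; split=> //; exists t.
apply: measurable_countable_preimage => //.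
exact: (sub_countable (subset_card_le (@subIsetr _ _ _)) cZ).
Qed.

(** An injection of [A] into the naturals cuts it into pieces [F k] with at most one point, to which
    countable additivity applies. *)
Lemma measure_preimage_esum (Z : T -> S) (A : set S) : countable A ->
  (forall s, measurable (Z @^-1` [set s])) ->
  P (Z @^-1` A) = (\esum_(s in A) P (Z @^-1` [set s]))%E.
Proof.
move=> cA mZ; have /countable_injP[f finj] := cA.
pose F k := A `&` f @^-1` [set k].
have FU : A = \bigcup_k F k.
  by apply/seteqP; split=> [s As|s [k _ []]] //; exists (f s).
have Ftriv : trivIset setT F.
  by move=> i j _ _ [s [[_ <-] [_ <-]]].
have mF k : measurable (Z @^-1` F k).
  apply: measurable_countable_preimage => //.
  exact: (sub_countable (subset_card_le (@subIsetl _ _ _)) cA).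
have PF k : P (Z @^-1` F k) = (\esum_(s in F k) P (Z @^-1` [set s]))%E.
  have [[s [As fs]]|no] := pselect (exists s, A s /\ f s = k).
    suff -> : F k = [set s] by rewrite esum_set1.
    apply/seteqP; split=> [u [Au fu]|u ->] //.
    by apply: finj; rewrite ?inE // fs.
  suff -> : F k = set0 by rewrite preimage_set0 measure0 esum_set0.
  by apply/seteqP; split=> // u [Au fu]; apply: no; exists u.
rewrite {2}FU nneseries_sum_bigcup // {1}FU preimage_bigcup.
rewrite measure_semi_bigcup //; first by apply: eq_eseriesr => k _; exact: PF.
- by move=> i j _ _ [t [/= Fi Fj]]; apply: Ftriv => //; exists (Z t).
- exact: bigcup_measurable.
Qed.

(** Sum [P(Y = s) <= P(Z = s) + max(P(Y = s) - P(Z = s), 0)] over [s] in [A] and the range of [Y];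
    the range makes the index set countable. *)
Lemma tv_dist_preimage (Y Z : T -> S) (A : set S) (eps : R) :
  countable (range Y) -> countable (range Z) ->
  (forall s, measurable (Y @^-1` [set s])) ->
  (forall s, measurable (Z @^-1` [set s])) ->
  (tv_dist P Y Z <= eps%:E)%E ->
  (P (Y @^-1` A) <= P (Z @^-1` A) + eps%:E)%E.
Proof.
move=> cY cZ mY mZ tv; pose B := A `&` range Y.
have cB : countable B.
  exact: (sub_countable (subset_card_le (@subIsetr _ _ _)) cY).
have -> : Y @^-1` A = Y @^-1` B.
  by apply/seteqP; split=> [t At|t []] //; split=> //; exists t.
apply: (@le_trans _ _ (P (Z @^-1` B) + eps%:E)%E); last first.
  rewrite leeD2r //; apply: le_measure; rewrite ?inE //.
  - exact: measurable_countable_range.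
  - exact: measurable_countable_range.
  - by move=> t [].
rewrite !measure_preimage_esum //.
apply: le_trans (leeD2l _ tv); rewrite /tv_dist.
have -> : (\esum_(x in [set: S]) maxe (P (Y @^-1` [set x]) - P (Z @^-1` [set x])) 0
   = \esum_(x in B) maxe (P (Y @^-1` [set x]) - P (Z @^-1` [set x])) 0 +
     \esum_(x in ~` B) maxe (P (Y @^-1` [set x]) - P (Z @^-1` [set x])) 0)%E.
  by rewrite (esumID B) ?setTI // => s _; rewrite le_max lexx orbT.
rewrite addeA; apply: (@le_trans _ _ (\esum_(s in B) P (Z @^-1` [set s]) +
   \esum_(x in B) maxe (P (Y @^-1` [set x]) - P (Z @^-1` [set x])) 0)%E); last first.
  by rewrite leeDl //; apply: esum_ge0 => s _; rewrite le_max lexx orbT.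
rewrite -esumD //; last by move=> s _; rewrite le_max lexx orbT.
apply: le_esum => s _.
rewrite -leeBlDl ?fin_num_measure //.
by rewrite le_max lexx.
Qed.

End CountableFibres.

Section RandomSeq.
Variables (d : measure_display) (T : measurableType d) (R : realType).
Variables (P : probability T R) (I : Type) (X : I -> {dRV P >-> R}).

Lemma measurable_map_fibre (l : seq I) (s : seq R) :
  measurable ((fun t => [seq X i t | i <- l]) @^-1` [set s]).
Proof.
elim: l s => [|i l IH] [|a s] /=.
- by rewrite (_ : _ @^-1` _ = setT) //; apply/seteqP; split.
- by rewrite (_ : _ @^-1` _ = set0) //; apply/seteqP; split.
- by rewrite (_ : _ @^-1` _ = set0) //; apply/seteqP; split.
rewrite (_ : _ @^-1` _ = X i @^-1` [set a] `&`
    (fun t => [seq X i t | i <- l]) @^-1` [set s]).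
  apply: measurableI; last exact: IH.
  by rewrite -[_ @^-1` _]setTI; apply: measurable_funP.
by apply/seteqP; split=> [t /= [<- <-]|t /= [-> ->]].
Qed.

Lemma countable_map_range (l : seq I) :
  countable (range (fun t => [seq X i t | i <- l])).
Proof.
elim: l => [|i l IH] /=.
  apply: (@sub_countable _ _ _ [set [::]]); last exact: countable1.
  by apply: subset_card_le => s [t _ <-].
have /countable_injP[f finj] := @countable_range _ _ _ _ (X i).
have /countable_injP[g ginj] := IH.
apply/countable_injP; exists (fun s => pickle (f (head 0 s), g (behead s))).
move=> s u; rewrite !inE => -[t _ <-] [v _ <-] /(pcan_inj pickleK) [/= E1 E2].
by congr (_ :: _); [apply: finj|apply: ginj]; rewrite ?inE.
Qed.

End RandomSeq.

(** * The law of the rounded variables *)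

Section FloorProcess.
Variables (d : measure_display) (T : measurableType d) (R : realType).
Variables (P : probability T R) (N : nat) (X : 'I_N.+1 -> {dRV P >-> R}).

Definition floor_seq (t : T) : seq nat :=
  [seq Num.truncn (r : R) | r <- [seq X i t | i <- enum 'I_N.+1]].

Local Notation Z := floor_seq.

(** The sample space becomes [seq nat] because a mass must be defined on all predicates, and there
    every predicate pulls back to a measurable event. *)
Definition floor_mass (A : pred (seq nat)) : R := fine (P (Z @^-1` [set s | A s])).

Lemma measurable_floor (A : set (seq nat)) : measurable (Z @^-1` A).
Proof.
rewrite (_ : _ @^-1` _ = (fun t => [seq X i t | i <- enum 'I_N.+1]) @^-1`
  [set s | A [seq Num.truncn (r : R) | r <- s]]) //.
apply: measurable_countable_range; last exact: measurable_map_fibre.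
exact: countable_map_range.
Qed.

Lemma mass_floorE (A : pred (seq nat)) :
  (floor_mass A)%:E = P (Z @^-1` [set s | A s]).
Proof. by rewrite fineK // fin_num_measure //; apply: measurable_floor. Qed.

Local Notation mass_Z := floor_mass.

Lemma is_mass_floor : is_mass mass_Z.
Proof.
split=> [A|A B C CE disj]; first exact: fine_ge0.
apply: EFin_inj; rewrite EFinD !mass_floorE -measureU; last first.
- by apply/seteqP; split=> // t [/= At Bt]; have := disj (Z t); rewrite At Bt.
- exact: measurable_floor.
- exact: measurable_floor.
congr (P _); apply/seteqP; split=> t /=; rewrite CE /=.
  by case/orP; [left|right].
by case=> ->; rewrite ?orbT.
Qed.

(* The junk values on sequences outside the range of floor_seq make the
   coordinates strictly increasing everywhere. *)
Definition floor_coord (k : nat) (s : seq nat) : nat :=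
  if sorted ltn s && (size s == N.+1) then nth 0%N s k else k.

Local Notation x := floor_coord.

Hypothesis X_ge0 : forall (i : 'I_N.+1) (t : T), 0 <= X i t.
Hypothesis X_gap : forall (i j : 'I_N.+1) (t : T), j = i.+1 :> nat ->
  X i t + 1 <= X j t.

Lemma nth_floor (t : T) (i : 'I_N.+1) : nth 0%N (Z t) i = Num.truncn (X i t).
Proof.
by rewrite /floor_seq -map_comp (nth_map i) ?size_enum_ord //= nth_ord_enum.
Qed.

Lemma size_floor (t : T) : size (Z t) = N.+1.
Proof. by rewrite /floor_seq 2!size_map size_enum_ord. Qed.

Lemma sorted_floor (t : T) : sorted ltn (Z t) && (size (Z t) == N.+1).
Proof.
rewrite size_floor eqxx andbT.
apply/(sortedP 0%N) => k; rewrite size_floor => kN.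
have kN' := ltnW kN.
have := nth_floor t (Ordinal kN'); have /= -> := nth_floor t (Ordinal kN) => /= ->.
(* Writing [fl] for rounding down: [fl X_k + 1 <= X_k + 1 <= X_(k+1) < fl X_(k+1) + 1]. *)
have gap := X_gap t (erefl : Ordinal kN = (Ordinal kN').+1 :> nat).
have /andP[le1 _] := truncn_itv (X_ge0 (Ordinal kN') t).
have /andP[_ lt2] := truncn_itv (X_ge0 (Ordinal kN) t).
rewrite -(ltr_nat R) -(ltrD2r 1).
rewrite [ltRHS]natr1; apply: le_lt_trans lt2; apply: le_trans gap.
by rewrite lerD2r.
Qed.

Lemma floor_process (t : T) (i : 'I_N.+1) : x i (Z t) = Num.truncn (X i t).
Proof. by rewrite /floor_coord sorted_floor nth_floor. Qed.

Lemma floor_coord_incr (s : seq nat) (i : nat) : (i < N)%N -> (x i s < x i.+1 s)%N.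
Proof.
rewrite /floor_coord; case: ifP => // /andP[/(sortedP 0%N) ss /eqP sN] iN.
by apply: ss; rewrite sN.
Qed.

Lemma omit_floor (t : T) (i : 'I_N.+1) :
  mkseq (fun k => x (bump i k) (Z t)) N =
  [seq Num.truncn r | r <- omit X i t].
Proof.
apply: (@eq_from_nth _ 0%N) => [|k]; rewrite size_mkseq.
  by rewrite (size_map (fun r : R => Num.truncn r)) size_tuple.
move=> kN.
rewrite nth_mkseq // (nth_map 0) ?size_tuple //.
rewrite -(tnth_nth 0 (omit X i t) (Ordinal kN)) tnth_mktuple.
exact: (floor_process t (lift i (Ordinal kN))).
Qed.

Lemma measurable_omit_fibre (i : 'I_N.+1) (s : N.+1.-1.-tuple R) :
  measurable (omit X i @^-1` [set s]).
Proof.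
rewrite (_ : _ @^-1` _ =
  (fun t => [seq X j t | j <- map (lift i) (enum 'I_N)]) @^-1` [set val s]).
  exact: measurable_map_fibre.
have E t : [seq X j t | j <- map (lift i) (enum 'I_N)] = val (omit X i t).
  by rewrite -map_comp.
by apply/seteqP; split=> t /=; rewrite E; [move=> ->|apply: val_inj].
Qed.

Lemma countable_omit_range (i : 'I_N.+1) : countable (range (omit X i)).
Proof.
have /countable_injP[f finj] := countable_map_range X (map (lift i) (enum 'I_N)).
apply/countable_injP; exists (fun s => f (val s)) => s u.
rewrite !inE => -[t _ <-] [v _ <-] /= h; apply: val_inj.
have E w : val (omit X i w) = [seq X j w | j <- map (lift i) (enum 'I_N)].
  by rewrite -map_comp.
by rewrite !E; apply: finj; rewrite ?inE // -!E.
Qed.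

(** Rounding acts entrywise, so a test on a rounded tuple is an event about the unrounded one, with
    the same total variation bound. *)
Lemma indist_floor (eps : R) :
  indistinguishable_subsets X eps -> indist mass_Z N x eps.
Proof.
move=> ind i j iN jN A.
have E (l : 'I_N.+1) :
    (mass_Z (fun s => A (mkseq (fun k => x (bump l k) s) N)))%:E =
    P (omit X l @^-1` [set s | A [seq Num.truncn (r : R) | r <- s]]).
  rewrite mass_floorE; congr (P _).
  by apply/seteqP; split=> t /=; rewrite omit_floor.
have iN' : (i < N.+1)%N by [].
have jN' : (j < N.+1)%N by [].
rewrite -lee_fin EFinD (E (Ordinal iN')) (E (Ordinal jN')).
apply: tv_dist_preimage => //.
- exact: countable_omit_range.
- exact: countable_omit_range.
- exact: measurable_omit_fibre.
- exact: measurable_omit_fibre.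
Qed.

Lemma floor_mass_le (c : R) (i : 'I_N.+1) :
  ((mass_Z (fun s => c <= (x i s)%:R)%R)%:E <= P [set t | (c <= X i t)%R])%E.
Proof.
rewrite mass_floorE; apply: le_measure; rewrite ?inE.
- exact: measurable_floor.
- rewrite (_ : [set t | _] = X i @^-1` `[c, +oo[); last first.
    by apply/seteqP; split=> t /=; rewrite in_itv /= andbT.
  by rewrite -[_ @^-1` _]setTI; apply: measurable_funP.
move=> t /=; rewrite floor_process => /le_trans; apply.
by have /andP[] := truncn_itv (X_ge0 i t).
Qed.

End FloorProcess.

(** After cancelling 9 ^ (k + 1), both 2 ^ (k + 1) and (k + 2)! are at least 2. *)
Lemma tower_const (k : nat) : (4 * 9 ^ k.+1 <= 18 ^ k.+1 * k.+2`!)%N.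
Proof.
have -> : (18 ^ k.+1 = 2 ^ k.+1 * 9 ^ k.+1)%N by rewrite -expnMn.
rewrite mulnAC leq_mul2r; apply/orP; right.
rewrite expnS factS; have := expn_gt0 2 k; have := fact_gt0 k.+1.
by move: (2 ^ k)%N (k.+1`!)%N => u v /= v0 u0; nia.
Qed.

Theorem theorem26 (R : realType) (n : nat) (hn : (4 <= n)%N) (eps : R)
    (eps_gt0 : 0 < eps)
    (eps_lt : eps < (18 ^+ (n - 3) * ((n - 2)`!)%:R)^-1)
    (d : measure_display) (T : measurableType d) (P : probability T R)
    (X : 'I_n -> {dRV P >-> R})
    (X_ge0 : forall (i : 'I_n) (t : T), 0 <= X i t)
    (X_gap : forall (i j : 'I_n) (t : T), j = i.+1 :> nat ->
       X i t + 1 <= X j t)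
    (X_indist : indistinguishable_subsets X eps)
    (last_index : 'I_n) (last_indexE : last_index = n.-1 :> nat) :
  (0 < P [set t | (iter (n - 2) (@exp2 R)
                    (18 ^+ (n - 3) * ((n - 2)`!)%:R * eps)^-1
                  <= X last_index t)%R])%E.
Proof.
have [k nE] : exists k, n = k.+4 by exists (n - 4)%N; lia.
subst n; move: eps_lt; have -> : (k.+4 - 3 = k.+1)%N by lia.
have -> : (k.+4 - 2 = k.+2)%N by lia.
have c_ge : 4 * 9 ^+ k.+1 <= 18 ^+ k.+1 * (k.+2`!)%:R :> R.
  have := tower_const k.
  by rewrite -(ler_nat R) (natrM _ 4) (natrM _ (18 ^ _)) !natrX.
have c0_gt0 : 0 < 4 * 9 ^+ k.+1 :> R by rewrite mulr_gt0 // exprn_gt0.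
move: c_ge; set c := (18 ^+ k.+1 * _).
move: (4 * 9 ^+ k.+1) c0_gt0 (@tower R k.+1) => c0 c0_gt0 tower0 c_ge eps_lt.
have ceps : c0 * eps < 1.
  rewrite mulrC -ltr_pdivlMr // div1r; apply: lt_le_trans eps_lt _.
  by rewrite lef_pV2 // posrE // (lt_le_trans c0_gt0).
have massT : floor_mass X predT = 1.
  apply: EFin_inj; rewrite mass_floorE (_ : _ @^-1` _ = setT) ?probability_setT //.
  by apply/seteqP; split.
have := tower0 _ _ _ _ (is_mass_floor X) (fun t i => @floor_coord_incr k.+3 t i)
  (indist_floor X_ge0 X_gap X_indist) eps_gt0.
rewrite massT => /(_ ceps) pos.
apply: lt_le_trans (floor_mass_le X_ge0 X_gap _ last_index).
rewrite lte_fin; apply: lt_le_trans pos _.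
apply: (le_mass (is_mass_floor X)) => s; rewrite last_indexE; apply: le_trans.
(* As [c0 <= c], the tower over [1 / (c0 * eps)] dominates the one over [1 / (c * eps)]. *)
apply: (@le_iter_exp2 R k.+2); rewrite div1r lef_pV2 ?posrE ?mulr_gt0 //.
  by rewrite ler_pM2r.
Qed.
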